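(* For the 2D ten-moment Gaussian closure system, with $\mathbf u=(\rho,\boldsymbol m,E_{11},E_{12},E_{22})^\top\in\mathbb R^6$, $\boldsymbol m=(m_1,m_2)^\top$, and the symmetric matrix $\mathbf E=(E_{ij})_{1\le i,j\le 2}$ ($E_{21}=E_{12}$), the invariant region $$G=\Big\{\mathbf u\in\mathbb R^6:\ \rho>0,\ \ \boldsymbol z^\top\Big(\mathbf E-\frac{\boldsymbol m\otimes\boldsymbol m}{2\rho}\Big)\boldsymbol z>0\quad\forall\,\boldsymbol z\in\mathbb R^2\setminus\{\mathbf 0\}\Big\}$$ has the GQL representation $$G_*=\Big\{\mathbf u\in\mathbb R^6:\ \rho>0,\ \ \varphi(\mathbf u;\boldsymbol z,\boldsymbol v_* )>0\quad\forall\,\boldsymbol v_*\in\mathbb R^2,\ \forall\,\boldsymbol z\in\mathbb R^2\setminus\{\mathbf 0\}\Big\},$$ where $$\varphi(\mathbf u;\boldsymbol z,\boldsymbol v_* ):=\boldsymbol z^\top\Big(\mathbf E-\boldsymbol m\otimes\boldsymbol v_*+\rho\,\frac{\boldsymbol v_*\otimes\boldsymbol v_*}{2}\Big)\boldsymbol z$$ is linear with respect to $\mathbf u$; that is, $G=G_*$.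
   Context: A GQL (equivalent linear) representation of a set is an equal set described by constraints that are all affine in $\mathbf u$, possibly quantified over auxiliary parameters independent of $\mathbf u$. $(\mathbf a\otimes\mathbf b)_{ij}=a_ib_j$. Here $\rho$ is the density, $\boldsymbol m$ the momentum and $\mathbf E$ the symmetric energy tensor. *)

(* Defs.v *)
From HB Require Import structures.
From mathcomp Require Import all_boot all_order all_algebra.
From mathcomp Require Import classical_sets reals.

Set Implicit Arguments.
Unset Strict Implicit.
Unset Printing Implicit Defensive.

Import Order.TTheory GRing.Theory Num.Theory.
Local Open Scope classical_set_scope.
Local Open Scope ring_scope.

Definition is_affine (R : realType) (n : nat) (f : 'cV[R]_n -> R) : Prop :=
  exists (g : {scalar 'cV[R]_n}) (c : R), forall u, f u = g u + c.

(* The index type [I] ranges over the constraints together with the values of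
   their auxiliary parameters; [strict i] tells whether constraint [i] reads
   [0 < f i u] or [0 <= f i u]. *)
Definition affinely_described (R : realType) (n : nat) (B : set 'cV[R]_n) :
    Prop :=
  exists (I : Type) (strict : I -> bool) (f : I -> 'cV[R]_n -> R),
    (forall i, is_affine (f i)) /\
    B = [set u | forall i, if strict i then 0 < f i u else 0 <= f i u].

Definition GQL_representation (R : realType) (n : nat) (A B : set 'cV[R]_n) :
    Prop :=
  affinely_described B /\ A = B.

Definition outer (R : realType) (n : nat) (a b : 'cV[R]_n) : 'M[R]_n :=
  \matrix_(i, j) (a i 0 * b j 0).

Definition quad (R : realType) (n : nat) (A : 'M[R]_n) (z : 'cV[R]_n) : R :=
  (z^T *m A *m z) 0 0.

(* State vectors are u = (rho, m_1, m_2, E_11, E_12, E_22), with entries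
   indexed from 0. *)
Definition density (R : realType) (u : 'cV[R]_6) : R := u 0 0.

Definition momentum (R : realType) (u : 'cV[R]_6) : 'cV[R]_2 :=
  \col_(i < 2) u (inord (1 + i)) 0.

(* With i, j in {0, 1}, the position 3 + i + j is 3 for E_11, 4 for both E_12
   and E_21, and 5 for E_22. *)
Definition energy (R : realType) (u : 'cV[R]_6) : 'M[R]_2 :=
  \matrix_(i < 2, j < 2) u (inord (3 + i + j)) 0.

Definition G (R : realType) : set 'cV[R]_6 :=
  [set u | 0 < density u /\
    forall z : 'cV[R]_2, z != 0 ->
      0 < quad (energy u
                - (2 * density u)^-1 *: outer (momentum u) (momentum u)) z].

Definition phi (R : realType) (u : 'cV[R]_6) (z v : 'cV[R]_2) : R :=
  quad (energy u - outer (momentum u) v + density u *: (2^-1 *: outer v v)) z.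

Definition Gstar (R : realType) : set 'cV[R]_6 :=
  [set u | 0 < density u /\
    forall v z : 'cV[R]_2, z != 0 -> 0 < phi u z v].

(* Main.v *)
From HB Require Import structures.
Require Import Defs.
From mathcomp Require Import all_boot all_order all_algebra.
From mathcomp Require Import classical_sets reals.
From mathcomp Require Import ring.

Set Implicit Arguments.
Unset Strict Implicit.
Unset Printing Implicit Defensive.

Import Order.TTheory GRing.Theory Num.Theory.
Local Open Scope classical_set_scope.
Local Open Scope ring_scope.

(** Fix a direction [z], put [s = z . m] and [t = z . v], and let [q] be the
    value of the quadratic form of [E] at [z].  Then [phi u z v] equals
    [q - s t + rho t^2 / 2], a quadratic polynomial in [t] with positive
    leading coefficient.  Completing the square ([phi_complete_square]) gives
    [phi u z v = (q - s^2 / (2 rho)) + (rho / 2) (t - s / rho)^2],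
    so the quantity constrained in [G] is the minimum of [phi u z v] over [v],
    attained at the velocity [v = m / rho], the same for every [z].  Hence
    requiring [phi u z v > 0] for all [v] is the same as requiring the
    constraint of [G].

    The new parameter [v] absorbs all the nonlinearity: density, momentum and
    energy are coordinate projections of [u], and for fixed [z] and [v] the
    function [phi] combines them with coefficients independent of [u]
    ([phi_scalar]), so [Gstar] is cut out by affine constraints indexed by the
    pairs [(v, z)] together with the constraint on the density. *)

Section Quad.
Variables (R : realType) (n : nat).
Implicit Types (A B : 'M[R]_n) (a b z : 'cV[R]_n).

Lemma quadD A B z : quad (A + B) z = quad A z + quad B z.
Proof. by rewrite /quad mulmxDr mulmxDl mxE. Qed.

Lemma quadZ c A z : quad (c *: A) z = c * quad A z.
Proof. by rewrite /quad -scalemxAr -scalemxAl mxE. Qed.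

Lemma quadB A B z : quad (A - B) z = quad A z - quad B z.
Proof. by rewrite quadD -scaleN1r quadZ mulN1r. Qed.

Definition dot a b : R := (a^T *m b) 0 0.

Lemma dotZr c a b : dot a (c *: b) = c * dot a b.
Proof. by rewrite /dot -scalemxAr mxE. Qed.

Lemma dotDr a b b' : dot a (b + b') = dot a b + dot a b'.
Proof. by rewrite /dot mulmxDr mxE. Qed.

Lemma outerE a b : outer a b = a *m b^T.
Proof. by apply/matrixP => i j; rewrite !mxE big_ord1 !mxE. Qed.

(** A rank-one matrix has a quadratic form that splits into two linear
    factors; this is what reduces the matrix inequality to a scalar one. *)
Lemma quad_outer a b z : quad (outer a b) z = dot z a * dot z b.
Proof.
rewrite /quad outerE mulmxA -mulmxA mxE big_ord1 -/(dot z a).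
by rewrite -[b^T *m z]trmxK trmx_mul trmxK mxE.
Qed.

End Quad.

Section Linearity.
Variable R : realType.
Implicit Types (u : 'cV[R]_6) (z v : 'cV[R]_2).

Lemma density_scalar : scalar (@density R).
Proof. by move=> a u w; rewrite /density !mxE. Qed.

Lemma momentum_linear : linear (@momentum R).
Proof. by move=> a u w; apply/matrixP => i j; rewrite !mxE. Qed.

Lemma energy_linear : linear (@energy R).
Proof. by move=> a u w; apply/matrixP => i j; rewrite !mxE. Qed.

Lemma phiE u z v : phi u z v =
  quad (energy u) z - dot z (momentum u) * dot z v
    + density u * (2^-1 * dot z v ^+ 2).
Proof. by rewrite /phi quadD quadB !quadZ !quad_outer expr2. Qed.

Lemma phi_scalar z v : scalar (fun u => phi u z v).
Proof.
move=> a u w /=; rewrite !phiE energy_linear momentum_linear density_scalar.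
by rewrite quadD quadZ dotDr dotZr; ring.
Qed.

Lemma is_affine_scalar n (f : 'cV[R]_n -> R) : scalar f -> is_affine f.
Proof.
move=> f_lin; pose f_mixin := GRing.isLinear.Build _ _ _ _ f f_lin.
pose g : {scalar 'cV[R]_n} := HB.pack f f_mixin.
by exists g, 0 => u; rewrite addr0.
Qed.

Lemma Gstar_affinely_described : affinely_described (@Gstar R).
Proof.
pose nonzero := {z : 'cV[R]_2 | z != 0}.
pose f (i : option ('cV[R]_2 * nonzero)) u :=
  if i is Some (v, z) then phi u (sval z) v else density u.
exists (option ('cV[R]_2 * nonzero))%type, xpredT, f; split.
  case=> [[v z]|]; apply: is_affine_scalar; first exact: phi_scalar.
  exact: density_scalar.
apply/seteqP; split=> u /=.
  by case=> rho_gt0 phi_gt0 [[v [z z_neq0]]|] //=; apply: phi_gt0.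
move=> f_gt0; split; first exact: (f_gt0 None).
by move=> v z z_neq0; apply: (f_gt0 (Some (v, exist _ z z_neq0))).
Qed.

End Linearity.

Section Minimization.
Variable R : realType.
Implicit Types (u : 'cV[R]_6) (z v : 'cV[R]_2).

Definition internal_energy u : 'M[R]_2 :=
  energy u - (2 * density u)^-1 *: outer (momentum u) (momentum u).

(** The defect between [phi] and the constraint of [G] is the kinetic energy,
    along [z], of the velocity [v] relative to the flow velocity [m / rho]. *)
Lemma phi_complete_square u z v : density u != 0 ->
  phi u z v = quad (internal_energy u) z
    + density u / 2 * dot z (v - (density u)^-1 *: momentum u) ^+ 2.
Proof.
move=> rho_neq0; rewrite phiE quadB quadZ quad_outer dotDr -scaleNr dotZr.
by field.
Qed.

Lemma G_eq_Gstar : @G R = @Gstar R.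
Proof.
apply/seteqP; split=> u [rho_gt0 u_pos]; split=> //;
  have rho_neq0 := lt0r_neq0 rho_gt0.
  move=> v z z_neq0; rewrite phi_complete_square //.
  apply: ltr_wpDr (u_pos z z_neq0).
  by rewrite mulr_ge0 ?sqr_ge0 ?divr_ge0 // ltW.
move=> z z_neq0.
(* The minimizing velocity, at which the square vanishes. *)
have := u_pos ((density u)^-1 *: momentum u) z z_neq0.
rewrite phi_complete_square // subrr -(scale0r 0) dotZr mul0r.
by rewrite expr0n mulr0 addr0.
Qed.

End Minimization.

Theorem theorem4p11 (R : realType) :
  GQL_representation (@G R) (@Gstar R) /\
  (forall z v : 'cV[R]_2, scalar (fun u : 'cV[R]_6 => phi u z v)).
Proof.
split; last exact: phi_scalar.
by split; [exact: Gstar_affinely_described | exact: G_eq_Gstar].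
Qed.
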